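(* There exist bijections $f,g\colon\mathbb{R}\to\mathbb{R}$, both Hamel functions, such that the union of their graphs $f\cup g$ is a Mazurkiewicz set.
   Context: Functions from $\mathbb{R}$ into $\mathbb{R}$ are identified with their graphs. A Mazurkiewicz set is a set $M\subseteq\mathbb{R}^2$ that intersects every straight line of $\mathbb{R}^2$ in exactly two points. A Hamel basis of $\mathbb{R}^2$ is a basis of $\mathbb{R}^2$ as a vector space over $\mathbb{Q}$. A function $h\colon\mathbb{R}\to\mathbb{R}$ is a Hamel function (in the sense of Płotka) if its graph $\{\langle x,h(x)\rangle: x\in\mathbb{R}\}$ is a Hamel basis of $\mathbb{R}^2$. *)

(* Defs.v *)
From mathcomp Require Import all_boot all_order all_algebra.
From mathcomp Require Import all_classical all_reals.

Set Implicit Arguments.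
Unset Strict Implicit.
Unset Printing Implicit Defensive.

Import Order.TTheory GRing.Theory Num.Theory.

Local Open Scope classical_set_scope.
Local Open Scope ring_scope.

Definition graph (R : realType) (h : R -> R) : set (R * R) :=
  [set p | p.2 = h p.1].

Definition line (R : realType) (a b c : R) : set (R * R) :=
  [set p | a * p.1 + b * p.2 = c].

Definition is_line (R : realType) (L : set (R * R)) : Prop :=
  exists a b c : R, (a, b) <> (0, 0) /\ L = line a b c.

Definition Mazurkiewicz (R : realType) (M : set (R * R)) : Prop :=
  forall L : set (R * R), is_line L ->
    exists p q : R * R, p <> q /\ M `&` L = [set p; q].

(* The plane as a vector space over rat. *)
Definition qscale (R : realType) (q : rat) (v : R * R) : R * R :=
  (ratr q * v.1, ratr q * v.2).

Definition qfree (R : realType) (B : set (R * R)) : Prop :=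
  forall (s : seq (R * R)) (c : R * R -> rat),
    uniq s -> (forall v, v \in s -> B v) ->
    \sum_(v <- s) qscale (c v) v = 0 ->
    forall v, v \in s -> c v = 0.

Definition qspanning (R : realType) (B : set (R * R)) : Prop :=
  forall w : R * R, exists (s : seq (R * R)) (c : R * R -> rat),
    (forall v, v \in s -> B v) /\ w = \sum_(v <- s) qscale (c v) v.

Definition Hamel_basis (R : realType) (B : set (R * R)) : Prop :=
  qfree B /\ qspanning B.

Definition Hamel_function (R : realType) (h : R -> R) : Prop :=
  Hamel_basis (graph h).

(* Main.v *)
Require Import Defs.
From mathcomp Require Import all_boot all_order all_algebra.
From mathcomp Require Import all_classical all_reals.
From mathcomp Require Import wochoice lebesgue_measure ring lra.

(** The two graphs are built by transfinite recursion as two disjoint sets of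
    coloured points: each task asks for a point of a given colour on a given
    line (unless the line already carries two points), or for a given vector to
    be in the rational span of a given colour.  The points added for a task
    depend on one real parameter lying outside a square-root-closed subfield
    [K] of the reals which contains all the data used so far; every accidental
    incidence or rational dependence would be a non-trivial equation of degree
    at most two over [K].

    That [K] is a proper subfield needs no cardinal arithmetic.  Elements of
    [K] are values of finite expressions whose leaves are earlier tasks, and
    tasks are themselves coded by finite expressions over the shortest initial
    segment [W] of a well-order of the reals such that the reals inject into
    the expressions over [W].  Ranking a task by the largest leaf of its code,
    a value outside [K] exists since the expressions over a proper initial
    segment of [W] do not suffice to code the reals. *)

Set Implicit Arguments.
Unset Strict Implicit.
Unset Printing Implicit Defensive.

Import Order.TTheory GRing.Theory Num.Theory.

Local Open Scope classical_set_scope.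
Local Open Scope ring_scope.

(** * Well-orders and well-founded recursion *)

Record strict_well_order (T : Type) (lt : T -> T -> Prop) : Prop := {
  swo_wf : well_founded lt;
  swo_trans : forall x y z, lt x y -> lt y z -> lt x z;
  swo_total : forall x y, [\/ lt x y, x = y | lt y x] }.

Lemma wf_minimum (T : Type) (lt : T -> T -> Prop) (A : set T) :
  well_founded lt -> A !=set0 -> exists2 x, A x & forall y, lt y x -> ~ A y.
Proof.
move=> wf [x Ax]; apply: contrapT => H; move: x Ax.
elim/(well_founded_ind wf) => x IH Ax; by apply: H; exists x.
Qed.

(** The library order is reflexive, with a unique minimum in each nonempty set. Totality,
    antisymmetry and transitivity are read off minima of sets of at most three elements, and the
    strict part is then taken. *)
Lemma exists_strict_well_order (T : eqType) :
  exists lt : T -> T -> Prop, strict_well_order lt.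
Proof.
have [r rwo] := well_ordering_principle T.
have min (A : set T) : A !=set0 -> exists2 z, A z & forall x, A x -> r z x.
  move=> [x Ax]; have [|z [[zA zm] _]] := rwo (fun x => `[< A x >]).
    by exists x; apply/asboolP.
  exists z; first exact/asboolP.
  by move=> y Ay; apply: zm; apply/asboolP.
have tot x y : r x y \/ r y x.
  have [|z [->|->] zm] := min [set x; y]; first by exists x; left.
    by left; apply: zm; right.
  by right; apply: zm; left.
have anti x y : r x y -> r y x -> x = y.
  move=> xy yx; have rr u : r u u by have [] := tot u u.
  have [|z [_ zu]] := rwo (fun u => (u == x) || (u == y)).
    by exists x; rewrite unfold_in eqxx.
  have zx : z = x.
    apply: zu; split; first by rewrite unfold_in eqxx.
    by move=> u; rewrite unfold_in => /orP[] /eqP->.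
  rewrite -zx; apply: zu; split; first by rewrite unfold_in eqxx orbT.
  by move=> u; rewrite unfold_in => /orP[] /eqP->.
have tr x y z : r x y -> r y z -> r x z.
  move=> xy yz; have [|w ww wm] := min [set u | [\/ u = x, u = y | u = z]].
    by exists x; constructor 1.
  have wx : r w x by apply: wm; constructor 1.
  have wy : r w y by apply: wm; constructor 2.
  have wz : r w z by apply: wm; constructor 3.
  case: ww => E; subst w => //.
    by rewrite (anti _ _ xy wx).
  by rewrite -(anti _ _ yz wy).
exists (fun x y => x <> y /\ r x y); split.
- move=> x; apply: contrapT => Nx.
  have [|z Nz zm] := min [set u | ~ Acc (fun x y => x <> y /\ r x y) u].
    by exists x.
  apply: Nz; constructor => y [yz ryz]; apply: contrapT => Ny.
  by apply: yz; apply: anti => //; exact: zm.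
- move=> x y z [xy rxy] [yz ryz]; split; last exact: tr ryz.
  by move=> xz; subst z; apply: xy; exact: anti.
- move=> x y; have [->|xy] := EM (x = y); first by constructor 2.
  have [rxy|ryx] := tot x y; first by constructor 1.
  by constructor 3; split => // E; apply: xy.
Qed.

(** Serves to compare tasks by rank, with an arbitrary well-order breaking ties. *)
Lemma lex_strict_well_order (T W : Type) (rk : T -> W)
    (ltT : T -> T -> Prop) (ltW : W -> W -> Prop) :
  strict_well_order ltT -> strict_well_order ltW ->
  strict_well_order
    (fun t u => ltW (rk t) (rk u) \/ (rk t = rk u /\ ltT t u)).
Proof.
move=> [wfT trT toT] [wfW trW toW]; split.
- suff H w t : rk t = w -> Acc
      (fun t u => ltW (rk t) (rk u) \/ (rk t = rk u /\ ltT t u)) t.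
    by move=> t; exact: H.
  move: t; elim/(well_founded_ind wfW): w => w IHw.
  elim/(well_founded_ind wfT) => t IHt tw; constructor => u [ut|[ut ltut]].
    by apply: IHw (erefl _); rewrite -tw.
  by apply: IHt ltut _; rewrite ut.
- move=> x y z [xy|[xy xy']] [yz|[yz yz']].
  + by left; exact: trW yz.
  + by left; rewrite -yz.
  + by left; rewrite xy.
  + by right; split; [rewrite xy|exact: trT yz'].
- move=> x y; have [xy|xy|xy] := toW (rk x) (rk y).
  + by constructor 1; left.
  + have [xy'|xy'|xy'] := toT x y.
    * by constructor 1; right.
    * by constructor 2.
    * by constructor 3; right.
  + by constructor 3; left.
Qed.

(** The earlier values are passed to [step] as a set of pairs, so later uses involve no dependent
    function, and set extensionality supplies the congruence needed to unfold [Fix]. *)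
Lemma wf_recursion (T V : Type) (lt : T -> T -> Prop)
    (step : T -> set (T * V) -> V) :
  well_founded lt ->
  exists h : T -> V,
    forall t, h t = step t [set x | lt x.1 t /\ x.2 = h x.1].
Proof.
move=> wf.
pose F t (rec : forall u, lt u t -> V) : V :=
  step t [set x | exists ut : lt x.1 t, x.2 = rec x.1 ut].
exists (Fix wf (fun=> V) F) => t; rewrite Fix_eq.
  congr step; apply/seteqP; split => [x [ut e]|x [ut e]]; first by split.
  by exists ut.
move=> u f g fg; congr step; apply/seteqP.
by split=> [x [ut e]|x [ut e]]; exists ut; rewrite e fg.
Qed.

(** * Finite expressions as codes, and the order on tasks *)

Inductive expr (A : Type) : Type :=
  | Leaf of A
  | Nat of nat
  | Node of nat & expr A & expr A.

Arguments Nat {A}.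

Fixpoint leaves_in (A : Type) (P : set A) (e : expr A) : Prop :=
  match e with
  | Leaf a => P a
  | Nat _ => True
  | Node _ l r => leaves_in P l /\ leaves_in P r
  end.

(* Node labels: 0 is subtraction, 1 is division, any other label is the square
   root of the left subterm. *)
Fixpoint eval (R : realType) (A : Type) (s : A -> R) (e : expr A) : R :=
  match e with
  | Leaf a => s a
  | Nat n => n%:R
  | Node 0 l r => eval s l - eval s r
  | Node 1 l r => eval s l / eval s r
  | Node _ l _ => Num.sqrt (eval s l)
  end.

(* Shifting the labels of the nodes leaves label 0 free to mark the places where
   the codes [phi a] are inserted, which makes grafting injective. *)
Fixpoint graft (A B : Type) (phi : A -> expr B) (e : expr A) : expr B :=
  match e with
  | Leaf a => Node 0 (Nat 0) (phi a)
  | Nat n => Nat n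
  | Node n l r => Node n.+1 (graft phi l) (graft phi r)
  end.

Lemma sub_leaves_in (A : Type) (P Q : set A) (e : expr A) :
  P `<=` Q -> leaves_in P e -> leaves_in Q e.
Proof. by move=> PQ; elim: e => //= n l IHl r IHr [/IHl ? /IHr]. Qed.

(** Stands in for the cardinal inequality $|T| \le \max(|P|, \aleph_0)$. *)
Definition codes (T A : Type) (P : set A) : Prop :=
  exists2 i : T -> expr A, injective i & forall x, leaves_in P (i x).

(** Substituting codes for leaves amounts to transitivity of this comparison. *)
Lemma codes_graft (T A B : Type) (P : set A) (Q : set B) (phi : A -> expr B) :
  (forall a a', P a -> P a' -> phi a = phi a' -> a = a') ->
  (forall a, P a -> leaves_in Q (phi a)) -> codes T P -> codes T Q.
Proof.
move=> phi_inj phiQ [i i_inj iP]; exists (graft phi \o i) => [x y /= xy|x].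
  apply: i_inj; move: (i x) (i y) (iP x) (iP y) xy => {x y}.
  elim=> [a|n|n l IHl r IHr] [a'|n'|n' l' r'] //=.
    by move=> Pa Pa' [/phi_inj->].
    by move=> _ _ [->].
  by move=> [Pl Pr] [Pl' Pr'] [-> /IHl-> // /IHr->].
rewrite /=; elim: (i x) (iP x) => //= [a /phiQ//|n l IHl r IHr].
by move=> [/IHl ? /IHr].
Qed.

Lemma codes_eval (R : realType) (A : Type) (P : set A) (s : A -> R) :
  (forall r, exists2 e, leaves_in P e & eval s e = r) -> codes R P.
Proof.
move=> H; have /choice[i iP] r : exists e, leaves_in P e /\ eval s e = r.
  by have [e] := H r; exists e.
exists i => [x y xy|x]; last by have [] := iP x.
by have [_ <-] := iP x; have [_ <-] := iP y; rewrite xy.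
Qed.

Lemma real_uncountable (R : realType) : ~ countable [set: R].
Proof.
move=> cR; have := @lebesgue_measure_itv R `[0, 1].
rewrite countable_lebesgue_measure0; last first.
  exact: sub_countable (subset_card_le _) cR.
by rewrite /= lte_fin ltr01 oppr0 adde0 => /eqP; rewrite eqe eq_sym oner_eq0.
Qed.

Lemma not_codes_set0 (R : realType) (A : Type) : ~ codes R (@set0 A).
Proof.
move=> [i i_inj i0]; apply: (@real_uncountable R).
(* The value at a leaf is a dummy: expressions with leaves in the empty set have none, and the
   others form a countable type. *)
pose fix pk (e : expr A) : GenTree.tree nat :=
  match e with
  | Leaf _ => GenTree.Leaf 0
  | Nat n => GenTree.Leaf n
  | Node n l r => GenTree.Node n [:: pk l; pk r]
  end.
apply/countable_injP; exists (pickle \o pk \o i) => x y _ _ /=.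
move=> /(pcan_inj pickleK) xy; apply: i_inj.
move: (i x) (i y) (i0 x) (i0 y) xy => {x y}.
elim=> [a|n|n l IHl r IHr] [a'|n'|n' l' r'] //=.
  by move=> _ _ [->].
by move=> [Pl Pr] [Pl' Pr'] [-> /IHl-> // /IHr->].
Qed.

(** The leaf [m] is recoded by the constant [Nat 0]. Grafting marks inserted codes, so there is no
    clash with constants already present. *)
Lemma codes_lt_of_le (T A : Type) (lt : A -> A -> Prop) (m : A) :
  codes T [set w | lt w m \/ w = m] -> codes T [set w | lt w m].
Proof.
pose phi w : expr A := if pselect (w = m) then Nat 0 else Leaf w.
apply: (@codes_graft _ _ _ _ _ phi) => [a b _ _|a]; rewrite /phi.
  case: (pselect (a = m)) => [am|am]; case: (pselect (b = m)) => [bm|bm] //=.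
    by rewrite am bm.
  by case.
by case: (pselect (a = m)) => // am [].
Qed.

(** If some segment below a point codes the reals, [W] is the least such segment, nonempty by
    uncountability; otherwise [W] is everything. Since adding the endpoint gains nothing, minimality
    also excludes the closed segments. *)
Lemma exists_coding_well_order (R : realType) :
  exists (lt : R -> R -> Prop) (W : set R),
    [/\ strict_well_order lt, W !=set0, codes R W
      & forall m, W m -> ~ codes R [set w | lt w m \/ w = m]].
Proof.
have [lt lt_wo] := exists_strict_well_order R; exists lt.
have codesT : codes R [set: R] by exists (@Leaf R) => // x y [].
have [[m Cm]|N] := EM (exists m, codes R [set w | lt w m]).
  have [|x Cx xm] := @wf_minimum _ lt [set m | codes R [set w | lt w m]]
    (swo_wf lt_wo); first by exists m.
  exists [set w | lt w x]; split => //.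
    apply/set0P/eqP => E; apply: (@not_codes_set0 R R).
    by move: Cx; rewrite /= E.
  by move=> w wx Cw; exact: xm wx (codes_lt_of_le Cw).
exists setT; split => //; first by exists 0.
by move=> m _ Cm; apply: N; exists m; exact: codes_lt_of_le.
Qed.

Lemma leaves_bound (A : Type) (lt : A -> A -> Prop) (W : set A) (e : expr A) :
  strict_well_order lt -> W !=set0 -> leaves_in W e ->
  exists2 m, W m & leaves_in [set w | lt w m \/ w = m] e.
Proof.
move=> [_ tr tot] [w Ww]; elim: e => [a Wa|n _|n l IHl r IHr /= [Wl Wr]].
- by exists a => //=; right.
- by exists w.
- have [m Wm lm] := IHl Wl; have [m' Wm' rm'] := IHr Wr.
  have sub u v : lt u v ->
      [set w | lt w u \/ w = u] `<=` [set w | lt w v \/ w = v].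
    by move=> uv x /= [xu|->]; left => //; exact: tr uv.
  have [mm'|mm'|mm'] := tot m m'.
  + by exists m' => //; split => //; apply: sub_leaves_in lm; exact: sub.
  + by exists m' => //; split => //; rewrite -mm'.
  + by exists m => //; split => //; apply: sub_leaves_in rm'; exact: sub.
Qed.

(* [(a, b, c, l, k)]: if [l], put a point of colour [k] on [a x + b y = c];
   otherwise put [(a, b)] in the span of colour [k].  See [task_done]. *)
Definition task (R : realType) : Type := (R * R * R * bool * bool)%type.

(** The rank of [t] bounds the leaves of its code. If every real were a value over the tasks up to
    [t], grafting their codes would code the reals over the closed segment at [rk t]. The natural
    number in a leaf lets each task contribute countably many reals. *)
Lemma exists_task_order (R : realType) :
  exists2 lt : task R -> task R -> Prop, strict_well_order lt &
    forall (t : task R) (s : task R * nat -> R), exists r, forall e,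
      leaves_in [set x | lt x.1 t \/ x.1 = t] e -> eval s e <> r.
Proof.
have [ltR [W [ltR_wo W0 [i i_inj iW] smallW]]] := exists_coding_well_order R.
have [ltT ltT_wo] := exists_strict_well_order (R * R * R * bool * bool)%type.
pose code (t : task R) : expr R :=
  let: (a, b, c, x, y) := t in
  Node x (i a) (Node y (i b) (i c)).
have code_inj : injective code.
  move=> [[[[a b] c] x] y] [[[[a' b'] c'] x'] y'] /=.
  move=> [xx' /i_inj-> yy' /i_inj-> /i_inj->].
  by move: xx' yy'; case: x; case: x'; case: y; case: y'.
have /choice[rk rkP] t : exists m,
    W m /\ leaves_in [set w | ltR w m \/ w = m] (code t).
  have [|m] := @leaves_bound _ ltR W (code t) ltR_wo W0; last by exists m.
  by move: t => [[[[a b] c] x] y] /=; do !split.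
exists (fun t u => ltR (rk t) (rk u) \/ (rk t = rk u /\ ltT t u)).
  exact: lex_strict_well_order.
move=> t s; apply: contrapT => N; have [Wt _] := rkP t.
apply: (smallW _ Wt).
pose lt t u := ltR (rk t) (rk u) \/ (rk t = rk u /\ ltT t u).
have : codes R [set x : task R * nat | lt x.1 t \/ x.1 = t].
  apply: (@codes_eval _ _ _ s) => r; apply: contrapT => Nr; apply: N.
  by exists r => e eP er; apply: Nr; exists e.
(* The index of the real contributed by a task is stored as a node label, which adds no leaf to the
   code. *)
apply: (@codes_graft _ _ _ _ _ (fun x => Node x.2 (code x.1) (Nat 0))).
  by move=> [u k] [u' k'] _ _ /= [-> /code_inj->].
move=> [u k] /= ut; split => //; have [_] := rkP u; apply: sub_leaves_in.
have [ltu|<-//] : ltR (rk u) (rk t) \/ rk u = rk t.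
  by case: ut => [[|[]]|->]; [left|right|right].
by move=> w /= [wu|->]; left => //; exact: (swo_trans ltR_wo) ltu.
Qed.

(** * Subfields of the reals closed under square roots *)

(** No side conditions are needed, because the inverse of 0 and the square root of a negative number
    are both 0. *)
Record sqrt_closed (R : realType) (K : set R) : Prop := {
  closed1 : K 1;
  closedB : forall x y, K x -> K y -> K (x - y);
  closed_div : forall x y, K x -> K y -> K (x / y);
  closed_sqrt : forall x, K x -> K (Num.sqrt x) }.

Section SqrtClosed.
Variables (R : realType) (K : set R) (Kc : sqrt_closed K).
Implicit Types x y t : R.

Lemma closed0 : K 0.
Proof. by rewrite -(subrr 1); apply: (closedB Kc); exact: closed1. Qed.

Lemma closedN x : K x -> K (- x).
Proof.
by move=> Kx; rewrite -sub0r; apply: (closedB Kc) => //; exact: closed0.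
Qed.

Lemma closedD x y : K x -> K y -> K (x + y).
Proof.
move=> Kx Ky; rewrite -(opprK y); apply: (closedB Kc) => //.
exact: closedN.
Qed.

Lemma closedM x y : K x -> K y -> K (x * y).
Proof.
move=> Kx Ky; rewrite -(invrK y) -[y^-1]mul1r.
by do 2!apply: (closed_div Kc) => //; exact: closed1.
Qed.

Lemma closed_nat n : K n%:R.
Proof.
elim: n => [|n IHn]; first exact: closed0.
by rewrite -natr1; apply: closedD => //; exact: closed1.
Qed.

Lemma closed_rat (q : rat) : K (ratr q).
Proof.
have Kint (z : int) : K z%:~R.
  case: z => n; first exact: closed_nat.
  by rewrite NegzE mulrNz; apply: closedN; exact: closed_nat.
by apply: (closed_div Kc); exact: Kint.
Qed.

Lemma closed_linear a b t : K a -> K b -> ~ K t -> a * t = b -> a = 0.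
Proof.
move=> Ka Kb Kt E; apply: contrapT => /eqP a0; apply: Kt.
by rewrite -(mulKf a0 t) E mulrC; exact: closed_div.
Qed.

(** By completing the square, [2 * a * t + b] is plus or minus the square root of the discriminant,
    hence in [K]; for nonzero [a] this would put [t] in [K]. The linear case remains. *)
Lemma closed_quadratic a b c t : K a -> K b -> K c -> ~ K t ->
  a * t ^+ 2 + b * t = c -> a = 0 /\ b = 0.
Proof.
move=> Ka Kb Kc' Kt E.
have a0 : a = 0.
  apply: contrapT => /eqP a0; apply: Kt.
  have K2 : K 2 := closed_nat 2.
  pose d := b ^+ 2 + 2 * 2 * a * c.
  have Kd : K (Num.sqrt d).
    apply: (closed_sqrt Kc); rewrite /d expr2.
    by apply: closedD; do !apply: closedM.
  have E2 : (2 * a * t + b) ^+ 2 = d by rewrite /d -E; ring.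
  have Ku : K (2 * a * t + b).
    have := sqrtr_sqr (2 * a * t + b); rewrite E2.
    case: (ger0P (2 * a * t + b)) => _ E3; first by rewrite -E3.
    by rewrite -[_ + b]opprK; apply: closedN; rewrite -E3.
  have -> : t = (2 * a * t + b - b) / (2 * a) by field.
  by apply: (closed_div Kc); [exact: (closedB Kc)|exact: closedM].
split => //; move: E; rewrite a0 mul0r add0r; exact: closed_linear.
Qed.

End SqrtClosed.

(** * Rational spans in the plane *)

Inductive qspan (R : realType) (B : set (R * R)) : R * R -> Prop :=
  | qspan0 : qspan B 0
  | qspan_add q v w : B v -> qspan B w -> qspan B (w + qscale q v).

Section QSpan.
Variable R : realType.
Implicit Types (B : set (R * R)) (u v w p : R * R) (q : rat).

Lemma pair_ext u v : u.1 = v.1 -> u.2 = v.2 -> u = v.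
Proof. by case: u v => [? ?] [? ?] /= -> ->. Qed.

Lemma qscaleDl q q' v : qscale (q + q') v = qscale q v + qscale q' v.
Proof. by apply: pair_ext; rewrite /= rmorphD mulrDl. Qed.

Lemma qscaleM q q' v : qscale q (qscale q' v) = qscale (q * q') v.
Proof. by apply: pair_ext; rewrite /= rmorphM mulrA. Qed.

Lemma qscaleDr q u v : qscale q (u + v) = qscale q u + qscale q v.
Proof. by apply: pair_ext; rewrite /= mulrDr. Qed.

Lemma qscale1 v : qscale 1 v = v.
Proof. by apply: pair_ext; rewrite /= rmorph1 mul1r. Qed.

Lemma qscale0 v : qscale 0 v = 0.
Proof. by apply: pair_ext; rewrite /= rmorph0 mul0r. Qed.

Lemma qscaler0 q : qscale q (0 : R * R) = 0.
Proof. by apply: pair_ext; rewrite /= mulr0. Qed.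

Lemma qspanD B u v : qspan B u -> qspan B v -> qspan B (u + v).
Proof.
move=> Bu; elim=> [|q w x Bw _ IH]; first by rewrite addr0.
by rewrite addrA; exact: qspan_add.
Qed.

Lemma qspanZ B q v : qspan B v -> qspan B (qscale q v).
Proof.
elim=> [|q' w x Bw _ IH]; first by rewrite qscaler0; exact: qspan0.
by rewrite qscaleDr qscaleM; exact: qspan_add.
Qed.

Lemma qspan_mem B v : B v -> qspan B v.
Proof.
move=> Bv; rewrite -(qscale1 v) -[qscale _ _]add0r.
by apply: qspan_add => //; exact: qspan0.
Qed.

Lemma qspan_sum B (s : seq (R * R)) (c : R * R -> rat) :
  (forall v, v \in s -> B v) -> qspan B (\sum_(v <- s) qscale (c v) v).
Proof.
elim: s => [|v s IHs] sB; first by rewrite big_nil; exact: qspan0.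
rewrite big_cons addrC; apply: qspan_add; first by apply: sB; rewrite mem_head.
by apply: IHs => w ws; apply: sB; rewrite inE ws orbT.
Qed.

(** The inductive span may use a vector repeatedly, whereas a sum has one coefficient per vector.
    The induction keeps the list duplicate-free and increments the coefficient of a repeated
    vector. *)
Lemma qspan_exists_sum B w :
  qspan B w -> exists (s : seq (R * R)) (c : R * R -> rat),
    (forall v, v \in s -> B v) /\ w = \sum_(v <- s) qscale (c v) v.
Proof.
suff H : qspan B w -> exists (s : seq (R * R)) (c : R * R -> rat), uniq s /\
    (forall v, v \in s -> B v) /\ w = \sum_(v <- s) qscale (c v) v.
  by move=> /H[s [c [_ ?]]]; exists s, c.
elim=> [|q v x Bv _ [s [c [us [sB ->]]]]].
  by exists [::], (fun=> 0); rewrite big_nil.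
have [vs|vs] := boolP (v \in s).
  exists s, (fun u => c u + (if u == v then q else 0)); split => //; split => //.
  rewrite (bigD1_seq v) //= [RHS](bigD1_seq v) //= eqxx qscaleDl -!addrA.
  congr (_ + _); rewrite addrC; congr (_ + _).
  by apply: eq_bigr => u /negbTE ->; rewrite addr0.
exists (v :: s), (fun u => if u == v then q else c u).
split; first by rewrite /= vs.
split=> [u|]; first by rewrite inE => /orP[/eqP->//|/sB].
rewrite big_cons eqxx addrC; congr (_ + _); apply: eq_big_seq => u us'.
by case: eqP => // E; move: vs; rewrite -E us'.
Qed.

Lemma qspan_addset B p w : qspan (B `|` [set p]) w ->
  exists q v, qspan B v /\ w = v + qscale q p.
Proof.
elim=> [|q v x [Bv|->] _ [q' [y [By ->]]]].
- by exists 0, 0; split; [exact: qspan0|rewrite qscale0 addr0].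
- by exists q', (y + qscale q v); split; [exact: qspan_add|rewrite addrAC].
- by exists (q' + q), y; split => //; rewrite qscaleDl addrA.
Qed.

Lemma qfree_addset B p : qfree B -> ~ qspan B p -> qfree (B `|` [set p]).
Proof.
move=> fB Bp s c us sB s0.
have [ps|ps] := boolP (p \in s); last first.
  apply: fB us _ s0 => v vs; case: (sB v vs) => // E.
  by move: ps; rewrite -E vs.
pose s' := rem p s.
have us' : uniq s' by exact: rem_uniq.
have s'B v : v \in s' -> B v.
  rewrite mem_rem_uniq // inE => /andP[/eqP vp /sB[//|/vp]]; by [].
move: s0; rewrite (perm_big _ (perm_to_rem ps)) big_cons /= -/s' => s0.
have cp : c p = 0.
  apply: contrapT => /eqP cp; apply: Bp.
  have -> : p = qscale (- (c p)^-1) (\sum_(v <- s') qscale (c v) v).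
    move/eqP: s0; rewrite addrC addr_eq0 => /eqP->.
    have -> : - qscale (c p) p = qscale (-1) (qscale (c p) p).
      by rewrite qscaleM mulN1r; apply: pair_ext; rewrite /= rmorphN mulNr.
    by rewrite !qscaleM mulrN1 opprK mulVf // qscale1.
  by apply: qspanZ; exact: qspan_sum.
move: s0; rewrite cp qscale0 add0r => s0 v vs.
have [->//|vp] := eqVneq v p.
by apply: (fB s' c us' s'B s0); rewrite mem_rem_uniq // inE vp.
Qed.

(** Source of independence: a point with a coordinate outside [K] is not in the span of points over
    [K]. *)
Lemma qspan_closed (K : set R) B v : sqrt_closed K ->
  (forall u, B u -> K u.1 /\ K u.2) -> qspan B v -> K v.1 /\ K v.2.
Proof.
move=> Kc BK; elim=> [|q u x /BK[Ku1 Ku2] _ [Kx1 Kx2]]; first by split; exact: closed0.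
by split; apply: closedD => //; apply: closedM => //; exact: closed_rat.
Qed.

Lemma sub_qspan B B' v : B `<=` B' -> qspan B v -> qspan B' v.
Proof.
move=> BB'; elim=> [|q u x /BB' Bu _ Bx]; first exact: qspan0.
exact: qspan_add.
Qed.

End QSpan.

(** * Admissible configurations and their extension by one task *)

Definition collinear (R : realType) (p q r : R * R) : Prop :=
  (q.1 - p.1) * (r.2 - p.2) = (q.2 - p.2) * (r.1 - p.1).

Definition config (R : realType) : Type := bool -> set (R * R).

(** The invariant of the recursion: each colour is a partial injection and a free set, and no line
    meets the union in three points. Every clause concerns finitely many points at a time, so it
    passes to unions of chains. *)
Record admissible (R : realType) (H : config R) : Prop := {
  adm_fst : forall k p q, H k p -> H k q -> p.1 = q.1 -> p = q;
  adm_snd : forall k p q, H k p -> H k q -> p.2 = q.2 -> p = q;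
  adm_disjoint : forall p, H true p -> ~ H false p;
  adm_collinear : forall i j k p q r, H i p -> H j q -> H k r ->
    collinear p q r -> [\/ p = q, q = r | p = r];
  adm_free : forall k, qfree (H k) }.

Definition add_points (R : realType) (H : config R) (v : seq (bool * (R * R))) :
  config R := fun i => [set x | H i x \/ (i, x) \in v].

Section Extension.
Variable R : realType.
Implicit Types (H : config R) (p q r w : R * R) (k : bool).

Lemma add_points_cons H k p v :
  add_points H ((k, p) :: v) = add_points (add_points H [:: (k, p)]) v.
Proof.
apply/funext => i; apply/seteqP; split => x; rewrite /add_points /=.
  by rewrite !inE => -[?|/orP[?|?]]; [left; left|left; right|right].
by rewrite !inE => -[[?|->]|->]; rewrite ?orbT; [left|right|right].
Qed.

Lemma add_pointP H k p i x :
  add_points H [:: (k, p)] i x <-> H i x \/ (i = k /\ x = p).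
Proof.
rewrite /add_points /= inE; split => -[]; try by left.
  by move=> /eqP[-> ->]; right.
by move=> [-> ->]; right.
Qed.

Lemma admissible_add_point H k p : admissible H ->
  (forall q, H k q -> p.1 <> q.1 /\ p.2 <> q.2) ->
  (forall i, ~ H i p) ->
  (forall i j q r, H i q -> H j r -> collinear p q r -> q = r) ->
  ~ qspan (H k) p -> admissible (add_points H [:: (k, p)]).
Proof.
move=> [H1 H2 Hd Hc Hf] p12 Hp pc ps; split.
- move=> i q r /add_pointP[Hq|[-> ->]] /add_pointP[Hr|[E ->]] //.
  + exact: H1 Hq Hr.
  + by subst i => E; have [] := p12 _ Hq; rewrite E.
  + by move=> E; have [] := p12 _ Hr; rewrite E.
- move=> i q r /add_pointP[Hq|[-> ->]] /add_pointP[Hr|[E ->]] //.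
  + exact: H2 Hq Hr.
  + by subst i => E; have [] := p12 _ Hq; rewrite E.
  + by move=> E; have [] := p12 _ Hr; rewrite E.
- move=> q /add_pointP[Hq|[E ->]] /add_pointP[Hr|[E' E2]].
  + exact: Hd Hq Hr.
  + by move: Hq; rewrite E2; exact: Hp.
  + exact: Hp Hr.
  + by rewrite -E in E'.
- move=> i1 i2 i3 q1 q2 q3.
  move=> /add_pointP[h1|[_ ->]] /add_pointP[h2|[_ ->]] /add_pointP[h3|[_ ->]].
  + exact: Hc h1 h2 h3.
  (* Collinearity is symmetric under permutation, so the new point can be moved to the first
     place. *)
  + move=> C; constructor 1; apply: (pc _ _ _ _ h1 h2); move: C.
    by rewrite /collinear => C; lra.
  + move=> C; constructor 3; apply: (pc _ _ _ _ h1 h3); move: C.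
    by rewrite /collinear => C; lra.
  + by constructor 2.
  + by move=> C; constructor 2; exact: (pc _ _ _ _ h2 h3).
  + by constructor 3.
  + by constructor 1.
  + by constructor 1.
- move=> i; have [->|ik] := eqVneq i k.
    have -> : add_points H [:: (k, p)] k = H k `|` [set p].
      apply/seteqP; split => x; first by move=> /add_pointP[|[_ ->]]; [left|right].
      by move=> [?|->]; apply/add_pointP; [left|right].
    exact: qfree_addset.
  suff -> : add_points H [:: (k, p)] i = H i by [].
  apply/seteqP; split => x; last by left.
  by move=> /add_pointP[//|[E _]]; rewrite E eqxx in ik.
Qed.

Variables (K : set R) (Kc : sqrt_closed K) (H : config R).
Hypotheses (HK : forall i p, H i p -> K p.1 /\ K p.2) (Hadm : admissible H).
Variables (a b c t : R).
Hypotheses (Ka : K a) (Kb : K b) (Kcc : K c) (Kt : ~ K t).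

Let KB := closedB Kc.
Let KM := closedM Kc.
Let KD := closedD Kc.

(* The new point moves along the line with parameter [t]. *)
Lemma extend_line k : (a, b) <> (0, 0) ->
  ~ (exists i j p q, [/\ H i p, H j q, p <> q, line a b c p & line a b c q]) ->
  ~ (exists2 p, H k p & line a b c p) ->
  exists2 p, line a b c p & admissible (add_points H [:: (k, p)]).
Proof.
move=> ab0 two one.
pose n := a ^+ 2 + b ^+ 2.
have n0 : n != 0.
  apply/eqP => /eqP; rewrite paddr_eq0 ?sqr_ge0 // !sqrf_eq0 => /andP[/eqP a0 /eqP b0].
  by apply: ab0; rewrite a0 b0.
have Kn : K n by rewrite /n !expr2; apply: KD; apply: KM.
(* The foot of the perpendicular from the origin: a point of the line with coordinates in [K], from
   which [p] is reached along the direction [(b, -a)]. *)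
pose x := a * c / n; pose y := b * c / n.
have Kx : K x by apply: closed_div => //; exact: KM.
have Ky : K y by apply: closed_div => //; exact: KM.
have xy : a * x + b * y = c by rewrite /x /y /n; field.
pose p : R * R := (x + b * t, y - a * t).
have p1K : K p.1 -> b = 0.
  move=> Kp; apply: (closed_linear Kc Kb (KB Kp Kx) Kt); rewrite /p /=; ring.
have p2K : K p.2 -> a = 0.
  move=> Kp; apply: (closed_linear Kc Ka (KB Ky Kp) Kt); rewrite /p /=; ring.
have pK : K p.1 -> K p.2 -> False.
  by move=> /p1K b0 /p2K a0; apply: ab0; rewrite a0 b0.
exists p; first by rewrite /line /p /=; rewrite -xy; ring.
apply: admissible_add_point => //.
(* A coordinate shared with [q] lies in [K], so the line is vertical or horizontal and contains [q],
   against [one]. *)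
- move=> q Hq; have [Kq1 Kq2] := HK Hq; split => E; apply: one; exists q => //.
    have b0 : b = 0 by apply: p1K; rewrite E.
    by rewrite /line /= -E -xy /p /= b0; ring.
  have a0 : a = 0 by apply: p2K; rewrite E.
  by rewrite /line /= -E -xy /p /= a0; ring.
- by move=> i /HK[Kp1 Kp2]; exact: pK.
- move=> i j q s Hq Hs; have [Kq1 Kq2] := HK Hq; have [Ks1 Ks2] := HK Hs.
  rewrite /collinear /p /= => C.
  (* Collinearity is affine in [t]. Vanishing of the coefficient of [t] says that [q - s] is
     parallel to the line; vanishing of the rest ([D] below) says that the foot is collinear with
     [q] and [s]. *)
  have E : b * (q.2 - s.2) + a * (q.1 - s.1) = 0.
    apply: (@closed_linear _ _ Kc _
      (q.2 * s.1 - q.1 * s.2 - x * (q.2 - s.2) - y * (s.1 - q.1)) t) => //.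
    - by apply: KD; apply: KM => //; exact: KB.
    - by apply: KB; [apply: KB; [apply: KB|]|]; apply: KM => //; exact: KB.
    - by lra.
  apply: contrapT => qs.
  have D : (x - s.1) * (q.2 - s.2) = (y - s.2) * (q.1 - s.1).
    have : t * (b * (q.2 - s.2) + a * (q.1 - s.1)) = 0 by rewrite E mulr0.
    by move=> ?; lra.
  (* Together with [F2], this forces [s] onto the line when [q] and [s] differ; then [q] is on it
     too, against [two]. *)
  have F1 : (q.1 - s.1) * (c - (a * s.1 + b * s.2)) = 0.
    have := congr1 ( *%R b) D; have := congr1 ( *%R (x - s.1)) E.
    by rewrite -xy => ? ?; lra.
  have F2 : (q.2 - s.2) * (c - (a * s.1 + b * s.2)) = 0.
    have := congr1 ( *%R a) D; have := congr1 ( *%R (y - s.2)) E.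
    by rewrite -xy => ? ?; lra.
  have sL : a * s.1 + b * s.2 = c.
    apply/eqP; rewrite eq_sym -subr_eq0; apply/eqP.
    move/eqP: F1; rewrite mulf_eq0 => /orP[|/eqP//]; rewrite subr_eq0 => /eqP q1.
    move/eqP: F2; rewrite mulf_eq0 => /orP[|/eqP//]; rewrite subr_eq0 => /eqP q2.
    by case: qs; exact: pair_ext.
  apply: two; exists i, j, q, s; split => //.
  by rewrite /line /= -sL; apply/eqP; rewrite -subr_eq0; apply/eqP; rewrite -E; ring.
- by move=> /(qspan_closed Kc (HK (i := k)))[]; exact: pK.
Qed.

(* The new points are [(t, t^2)] and its translate by [(a, b)]. *)
Lemma extend_span k : a <> 0 -> b <> 0 -> ~ qspan (H k) (a, b) ->
  exists p, admissible
    (add_points H [:: (k, p); (k, (p.1 + a, p.2 + b))]).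
Proof.
move=> a0 b0 Hab; exists (t, t ^+ 2).
set p := (t, t ^+ 2); set p' := (p.1 + a, p.2 + b).
have K0 := closed0 Kc; have K1 := closed1 Kc.
have Kt2 z : K z -> t ^+ 2 <> z.
  move=> Kz E; have [] := @closed_quadratic _ _ Kc 1 0 z t K1 K0 Kz Kt.
    by rewrite -E; ring.
  by move/eqP; rewrite oner_eq0.
(* Why a parabola is used: the coefficients of [t ^+ 2] and [t] are the coordinate differences of
   [q] and [s], up to sign, so both vanish. The offset [(u, v)] covers [p] and its translate at
   once. *)
have ptc u v q s : K u -> K v -> K q.1 -> K q.2 -> K s.1 -> K s.2 ->
    collinear (t + u, t ^+ 2 + v) q s -> q = s.
  move=> Ku Kv Kq1 Kq2 Ks1 Ks2; rewrite /collinear /= => C.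
  have [|||||/eqP] := @closed_quadratic _ _ Kc (s.1 - q.1) (q.2 - s.2)
     (q.2 * s.1 - q.1 * s.2 - u * (q.2 - s.2) - v * (s.1 - q.1)) t.
  - exact: KB.
  - exact: KB.
  - by apply: KB; [apply: KB; [apply: KB|]|]; apply: KM => //; exact: KB.
  - by [].
  - by lra.
  by rewrite subr_eq0 => /eqP E1 /eqP; rewrite subr_eq0 => /eqP E2; exact: pair_ext.
have adm1 : admissible (add_points H [:: (k, p)]).
  apply: admissible_add_point => //.
  - move=> q /HK[Kq1 Kq2]; split; last exact: Kt2.
    by move=> /= E; apply: Kt; rewrite E.
  - by move=> i /HK[].
  - move=> i j q s /HK[Kq1 Kq2] /HK[Ks1 Ks2] C; apply: (ptc 0 0) => //.
    by rewrite !addr0.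
  - by move=> /(qspan_closed Kc (HK (i := k)))[].
have Kta z : K z -> t + a <> z.
  by move=> Kz E; apply: Kt; rewrite -(addrK a t) E; exact: KB.
(* Here the coefficient of [t ^+ 2] is [a], which is nonzero. *)
have ppq q : K q.1 -> K q.2 -> ~ collinear p p' q.
  move=> Kq1 Kq2; rewrite /collinear /= => C.
  have [|||||/a0//] := @closed_quadratic _ _ Kc a (- b) (a * q.2 - b * q.1) t.
  - by [].
  - exact: closedN.
  - by apply: KB; exact: KM.
  - by [].
  - by lra.
rewrite add_points_cons; apply: admissible_add_point => //.
- move=> q /add_pointP[/HK[Kq1 Kq2]|[_ ->]] /=.
    split; first exact: Kta.
    by move=> E; apply: (Kt2 (q.2 - b)); [exact: KB|rewrite -E addrK].
  (* A zero coordinate of the translation would make two points of one colour share a coordinate;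
     hence the restriction on span tasks. *)
  by split=> E; [apply: a0|apply: b0]; lra.
- move=> i /add_pointP[/HK[Kp1 _]|[_ [E _]]]; first exact: (Kta _ Kp1).
  by apply: a0; lra.
- move=> i j q s /add_pointP[/HK[Kq1 Kq2]|[_ ->]] /add_pointP[/HK[Ks1 Ks2]|[_ ->]] //.
  + exact: ptc.
  + by move=> C; case: (ppq q) => //; move: C; rewrite /collinear => C; lra.
  + by move=> C; case: (ppq s) => //; move: C; rewrite /collinear => C; lra.
- have -> : add_points H [:: (k, p)] k = H k `|` [set p].
    apply/seteqP; split => x; first by move=> /add_pointP[|[_ ->]]; [left|right].
    by move=> [?|->]; apply/add_pointP; [left|right].
  move=> /qspan_addset[q [v [Hv E]]].
  have [Kv1 Kv2] := qspan_closed Kc (HK (i := k)) Hv.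
  have Kq := closed_rat Kc q.
  (* Comparing first coordinates of [p' = v + qscale q p] gives a linear equation in [t] over [K],
     so [q] is 1 and [(a, b)] equals [v], which lies in the old span. *)
  have q1 : 1 - ratr q = 0 :> R.
    apply: (@closed_linear _ _ Kc _ (v.1 - a) t); [exact: KB|exact: KB|by []|].
    by have := congr1 fst E; rewrite /=  => E1; lra.
  apply: Hab; suff -> : (a, b) = v by [].
  have q1' : ratr q = 1 :> R by apply/eqP; rewrite eq_sym -subr_eq0 q1.
  apply: pair_ext.
    by have := congr1 fst E; rewrite /= q1' => E1; lra.
  by have := congr1 snd E; rewrite /= q1' => E1; lra.
Qed.

End Extension.

(** Degenerate lines and vectors with a zero coordinate count as done; [complete_Hamel] recovers the
    latter vectors as sums. *)
Definition task_done (R : realType) (t : task R) (H : config R) : Prop :=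
  let: (a, b, c, is_line_task, k) := t in
  if is_line_task then (a, b) <> (0, 0) ->
    (exists i j p q,
       [/\ H i p, H j q, p <> q, line a b c p & line a b c q]) \/
    (exists2 p, H k p & line a b c p)
  else a <> 0 -> b <> 0 -> qspan (H k) (a, b).

Lemma sub_task_done (R : realType) (t : task R) (H H' : config R) :
  (forall i, H i `<=` H' i) -> task_done t H -> task_done t H'.
Proof.
move=> HH'; move: t => [[[[a b] c] [] k]] /=.
  move=> D /D[[i [j [p [q [Hp Hq pq Lp Lq]]]]]|[p Hp Lp]]; last first.
    by right; exists p => //; exact: HH'.
  by left; exists i, j, p, q; split => //; exact: HH'.
by move=> D a0 b0; apply: sub_qspan (D a0 b0); exact: HH'.
Qed.

Lemma add_points0 (R : realType) (H : config R) : add_points H [::] = H.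
Proof.
apply/funext => i; apply/seteqP; split => x; rewrite /add_points /=; last by left.
by case.
Qed.

Lemma extend_task (R : realType) (K : set R) (H : config R) (a b c r : R)
    (l k : bool) :
  sqrt_closed K -> (forall i p, H i p -> K p.1 /\ K p.2) -> admissible H ->
  K a -> K b -> K c -> ~ K r ->
  exists v, admissible (add_points H v) /\
    task_done (a, b, c, l, k) (add_points H v).
Proof.
move=> Kc HK Hadm Ka Kb Kcc Kr.
have [D|ND] := EM (task_done (a, b, c, l, k) H).
  by exists [::]; rewrite add_points0.
case: l ND => /= ND.
  have [ab0 ND'] : (a, b) <> (0, 0) /\ ~ ((exists i j p q,
       [/\ H i p, H j q, p <> q, line a b c p & line a b c q]) \/
    (exists2 p, H k p & line a b c p)).
    by split=> ?; apply: ND.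
  have [||p Lp padm] := extend_line Kc HK Hadm Ka Kb Kcc Kr (k := k) ab0.
  - by move=> D; apply: ND'; left.
  - by move=> D; apply: ND'; right.
  exists [:: (k, p)]; split => // _; right; exists p => //.
  by apply/add_pointP; right.
have [a0 b0 Hab] : [/\ a <> 0, b <> 0 & ~ qspan (H k) (a, b)].
  by split=> ?; apply: ND.
have [p padm] := extend_span Kc HK Hadm Ka Kb Kr a0 b0 Hab.
exists [:: (k, p); (k, (p.1 + a, p.2 + b))]; split => // _ _.
set H' := add_points _ _.
have Hp : H' k p by right; rewrite !inE eqxx.
have Hp' : H' k (p.1 + a, p.2 + b) by right; rewrite !inE eqxx orbT.
have -> : (a, b) = (p.1 + a, p.2 + b) + qscale (-1) p.
  by apply: pair_ext; rewrite /= rmorphN1; ring.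
by apply: qspan_add => //; exact: qspan_mem.
Qed.

(** * Unions of chains and the transfinite construction *)

Lemma admissible_chain (R : realType) (T : Type) (D : set T) (F : T -> config R) :
  (forall t u, D t -> D u ->
     (forall i, F t i `<=` F u i) \/ (forall i, F u i `<=` F t i)) ->
  (forall t, D t -> admissible (F t)) ->
  admissible (fun i => \bigcup_(t in D) F t i).
Proof.
move=> tot adm; set U := fun i => _.
(* Finitely many points of the union already lie in one member. The list must be nonempty because
   [D] may be empty, as it is below the first task. *)
have fin (s : seq (bool * (R * R))) : s != [::] ->
    (forall x, x \in s -> U x.1 x.2) ->
    exists2 t, D t & forall x, x \in s -> F t x.1 x.2.
  elim: s => // x s IHs _ sU.
  have [t Dt Ftx] : U x.1 x.2 by apply: sU; rewrite mem_head.
  have [s0|s0] := eqVneq s [::].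
    by exists t => // y; rewrite s0 inE => /eqP->.
  have [//||u Du us] := IHs; first by move=> y ys; apply: sU; rewrite inE ys orbT.
  have [tu|ut] := tot t u Dt Du.
    by exists u => // y; rewrite inE => /orP[/eqP->|/us//]; exact: tu.
  by exists t => // y; rewrite inE => /orP[/eqP->//|/us]; exact: ut.
have fin2 i j p q : U i p -> U j q -> exists2 t, D t & F t i p /\ F t j q.
  move=> Up Uq; have [//||t Dt ts] := fin [:: (i, p); (j, q)].
    by move=> x; rewrite !inE => /orP[] /eqP->.
  exists t => //.
  by split; [apply: (ts (i, p))|apply: (ts (j, q))]; rewrite !inE eqxx ?orbT.
split.
- move=> k p q Up Uq; have [t Dt [Fp Fq]] := fin2 _ _ _ _ Up Uq.
  exact: (adm_fst (adm t Dt) Fp Fq).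
- move=> k p q Up Uq; have [t Dt [Fp Fq]] := fin2 _ _ _ _ Up Uq.
  exact: (adm_snd (adm t Dt) Fp Fq).
- move=> p Up Uq; have [t Dt [Fp Fq]] := fin2 _ _ _ _ Up Uq.
  exact: (adm_disjoint (adm t Dt) Fp Fq).
- move=> i j k p q r Up Uq Ur.
  have [//||t Dt ts] := fin [:: (i, p); (j, q); (k, r)].
    by move=> x; rewrite !inE => /or3P[] /eqP->.
  apply: (adm_collinear (adm t Dt) (ts (i, p) _) (ts (j, q) _) (ts (k, r) _));
    by rewrite !inE eqxx ?orbT.
- move=> k s c us sU s0 v vs.
  have [|x|t Dt ts] := fin [seq (k, u) | u <- s].
  - by case: s vs {us sU s0}.
  - by move=> /mapP[u us' ->]; exact: sU.
  apply: (adm_free (adm t Dt) (k := k) us _ s0 vs) => u us'.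
  by apply: (ts (k, u)); exact: map_f.
Qed.

Lemma sqrt_closed_eval (R : realType) (A : Type) (P : set A) (s : A -> R) :
  sqrt_closed [set r | exists2 e, leaves_in P e & eval s e = r].
Proof.
split.
- by exists (Nat 1).
- by move=> _ _ [e Pe <-] [e' Pe' <-]; exists (Node 0 e e').
- by move=> _ _ [e Pe <-] [e' Pe' <-]; exists (Node 1 e e').
- by move=> _ [e Pe <-]; exists (Node 2 e e).
Qed.

Lemma exists_complete_config (R : realType) :
  exists2 H : config R, admissible H & forall t, task_done t H.
Proof.
have [lt lt_wo small] := exists_task_order R.
pose hist (S : set (task R * seq (bool * (R * R)))) : config R :=
  fun i => [set x | exists2 y, S y & (i, x) \in y.2].
pose good (t : task R) (H : config R) v :=
  admissible (add_points H v) /\ task_done t (add_points H v).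
(* [xget] falls back on [[::]] when no good list exists; [all_good] shows by induction that one
   always does. *)
pose step t S := xget [::] [set v | good t (hist S) v].
have [h hE] := wf_recursion step (swo_wf lt_wo).
pose below t : config R :=
  fun i => [set x | exists2 u, lt u t & (i, x) \in h u].
pose upto t := add_points (below t) (h t).
have {}hE t : h t = xget [::] [set v | good t (below t) v].
  rewrite hE /step; congr (xget _ _).
  suff -> : hist [set x | lt x.1 t /\ x.2 = h x.1] = below t by [].
  apply/funext => i; apply/seteqP; split => x.
    by move=> [[u v] /= [ut ->] xh]; exists u.
  by move=> [u ut xh]; exists (u, h u).
have upto_mono t u : lt t u -> forall i, upto t i `<=` upto u i.
  move=> tu i x [[w wt xw]|xt]; left; last by exists t.
  by exists w => //; exact: (swo_trans lt_wo) tu.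
have tot t u :
    (forall i, upto t i `<=` upto u i) \/ (forall i, upto u i `<=` upto t i).
  have [tu|->|ut] := swo_total lt_wo t u; [left| |right]; try exact: upto_mono.
  by left => i x.
(* Written as a union of the increasing configurations [upto u], [below t] falls under
   [admissible_chain]. *)
have belowE t : below t = fun i => \bigcup_(u in [set u | lt u t]) upto u i.
  apply/funext => i; apply/seteqP; split => x.
    by move=> [u ut xu]; exists u => //; right.
  move=> [u ut [[w wu xw]|xu]]; last by exists u.
  by exists w => //; exact: (swo_trans lt_wo) ut.
have all_good t : good t (below t) (h t).
  elim/(well_founded_ind (swo_wf lt_wo)): t => t IH.
  have adm : admissible (below t).
    rewrite belowE; apply: admissible_chain => [u v _ _|u /IH[]//]; exact: tot.
  suff [v gv] : exists v, good t (below t) v.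
    by rewrite hE; exact: (xgetI [::] (P := [set v | good t (below t) v]) gv).
  (* [s (u, _)] enumerates the coefficients of [u] and, if [u] precedes [t], the
     coordinates of the points added for [u]. *)
  pose s (x : task R * nat) : R := nth 0
    ([:: x.1.1.1.1.1; x.1.1.1.1.2; x.1.1.1.2] ++
     (if pselect (lt x.1 t) then
        flatten [seq [:: y.2.1; y.2.2] | y <- h x.1] else [::])) x.2.
  pose P := [set x : task R * nat | lt x.1 t \/ x.1 = t].
  have [r rP] := small t s.
  pose K := [set r | exists2 e, leaves_in P e & eval s e = r].
  have Ks u k : lt u t \/ u = t -> K (s (u, k)) by exists (Leaf (u, k)).
  have := @extend_task R K (below t) t.1.1.1.1 t.1.1.1.2 t.1.1.2 r t.1.2 t.2.
  have -> : (t.1.1.1.1, t.1.1.1.2, t.1.1.2, t.1.2, t.2) = t.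
    by case: t {IH adm s P rP K Ks} => [[[[? ?] ?] ?] ?].
  apply => //.
  - exact: sqrt_closed_eval.
  - move=> i p [u ut pu].
    have Kmem z : z \in flatten [seq [:: y.2.1; y.2.2] | y <- h u] -> K z.
      move=> zu.
      (* The offset 3 skips the coefficients of [u], listed before the coordinates of its points. *)
      have := Ks u (3 + index z (flatten [seq [:: y.2.1; y.2.2] | y <- h u]))
        (or_introl ut).
      by rewrite /s /=; case: (pselect (lt u t)) => //= _; rewrite nth_index.
    split; apply: Kmem; apply/flattenP; exists [:: p.1; p.2];
      rewrite ?inE ?eqxx ?orbT //; by apply/mapP; exists (i, p).
  - exact: (Ks t 0%N (or_intror erefl)).
  - exact: (Ks t 1%N (or_intror erefl)).
  - exact: (Ks t 2%N (or_intror erefl)).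
  - by move=> [e Pe er]; exact: rP Pe er.
exists (fun i => \bigcup_(t in setT) upto t i).
  by apply: admissible_chain => [t u _ _|t _]; [exact: tot|case: (all_good t)].
move=> t; have [_] := all_good t; apply: sub_task_done => i x Hx.
by exists t.
Qed.

(** * Reading off the two functions from a complete configuration *)

Lemma line_collinear (R : realType) (a b c : R) (p q r : R * R) :
  (a, b) <> (0, 0) -> line a b c p -> line a b c q -> line a b c r ->
  collinear p q r.
Proof.
rewrite /line /collinear /= => ab0 Lp Lq Lr.
have [a0|a0] := eqVneq a 0.
  have b0 : b != 0 by apply/eqP => b0; apply: ab0; rewrite a0 b0.
  apply: (mulfI b0).
  have Eq : b * (q.2 - p.2) = 0 by move: Lp Lq; rewrite a0 => Lp Lq; lra.
  have Er : b * (r.2 - p.2) = 0 by move: Lp Lr; rewrite a0 => Lp Lr; lra.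
  by rewrite mulrCA Er mulr0 mulrA Eq mul0r.
apply: (mulfI a0).
have Eq : a * (q.1 - p.1) = - b * (q.2 - p.2) by lra.
have Er : a * (r.1 - p.1) = - b * (r.2 - p.2) by lra.
by rewrite mulrA Eq mulrCA Er; ring.
Qed.

Section Complete.
Variables (R : realType) (H : config R).
Hypotheses (Hadm : admissible H) (Hdone : forall t, task_done t H).

(** The tasks of both colours for this line yield either two points outright or one point of each
    colour, distinct by disjointness. *)
Lemma complete_line (a b c : R) : (a, b) <> (0, 0) ->
  exists i j p q, [/\ H i p, H j q, p <> q, line a b c p & line a b c q].
Proof.
move=> ab0; have [//|[p Hp Lp]] := Hdone (a, b, c, true, true) ab0.
have [//|[q Hq Lq]] := Hdone (a, b, c, true, false) ab0.
exists true, false, p, q; split => // pq.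
by apply: (adm_disjoint Hadm) Hp _; rewrite pq.
Qed.

(** A vertical line carries two points. They cannot have the same colour, since they share the first
    coordinate, so both colours occur. *)
Lemma complete_fst k x : exists y, H k (x, y).
Proof.
have [|i [j [p [q [Hp Hq pq]]]]] := @complete_line 1 0 x.
  by case=> /eqP; rewrite oner_eq0.
rewrite /line /= !mul1r !mul0r !addr0 => Lp Lq.
have [<-|ik] := eqVneq i k; first by exists p.2; rewrite -Lp -surjective_pairing.
have [<-|jk] := eqVneq j k; first by exists q.2; rewrite -Lq -surjective_pairing.
have ij : i = j by case: i j k ik jk {Hp Hq} => [] [] [].
case: pq; apply: (adm_fst Hadm) Hp _ _; first by rewrite ij.
by rewrite Lp Lq.
Qed.

Lemma complete_snd k y : exists x, H k (x, y).
Proof.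
have [|i [j [p [q [Hp Hq pq]]]]] := @complete_line 0 1 y.
  by case=> /eqP; rewrite oner_eq0.
rewrite /line /= !mul1r !mul0r !add0r => Lp Lq.
have [<-|ik] := eqVneq i k; first by exists p.1; rewrite -Lp -surjective_pairing.
have [<-|jk] := eqVneq j k; first by exists q.1; rewrite -Lq -surjective_pairing.
have ij : i = j by case: i j k ik jk {Hp Hq} => [] [] [].
case: pq; apply: (adm_snd Hadm) Hp _ _; first by rewrite ij.
by rewrite Lp Lq.
Qed.

Lemma complete_Hamel k : Hamel_basis (H k).
Proof.
split=> [|w]; first exact: (adm_free Hadm).
apply: qspan_exists_sum.
(* Any vector is thus a sum of two vectors without zero coordinates, to which span tasks apply. *)
have nz (z : R) : exists u, u <> 0 /\ z - u <> 0.
  have [->|z1] := eqVneq z 1.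
    by exists 2; split=> E; lra.
  exists 1; split=> /eqP; first by rewrite oner_eq0.
  by rewrite subr_eq0 (negbTE z1).
have [u [u0 wu0]] := nz w.1; have [v [v0 wv0]] := nz w.2.
have -> : w = (u, v) + (w.1 - u, w.2 - v) by apply: pair_ext; rewrite /=; ring.
apply: qspanD.
  exact: (Hdone (u, v, 0, false, k)).
exact: (Hdone (w.1 - u, w.2 - v, 0, false, k)).
Qed.

Lemma complete_function k :
  exists f : R -> R, bijective f /\ graph f = H k.
Proof.
have /choice[f fH] := complete_fst k.
have /choice[g gH] := complete_snd k.
have fE x y : H k (x, y) -> y = f x.
  by move=> Hxy; case: (adm_fst Hadm Hxy (fH x) erefl).
exists f; split; last first.
  apply/seteqP; split => [[x y] xy|[x y] /fE //].
  by rewrite (_ : y = f x) //; exact: fH.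
exists g => [x|y]; last by rewrite -(fE _ _ (gH y)).
by case: (adm_snd Hadm (gH (f x)) (fH x) erefl).
Qed.

(** Two points come from [complete_line]; a third point on the line would be collinear with them,
    hence equal to one of them. *)
Lemma complete_Mazurkiewicz : Mazurkiewicz (H true `|` H false).
Proof.
have HU i p : H i p -> (H true `|` H false) p by case: i; [left|right].
have UH p : (H true `|` H false) p -> exists i, H i p.
  by case; [exists true|exists false].
move=> _ [a [b [c [ab0 ->]]]].
have [i [j [p [q [Hp Hq pq Lp Lq]]]]] := @complete_line a b c ab0.
exists p, q; split => //; apply/seteqP; split => x; last first.
  by move=> [->|->]; split => //; [exact: HU Hp|exact: HU Hq].
move=> [/UH[k Hx] Lx].
have [//|->|->] := adm_collinear Hadm Hp Hq Hx (line_collinear ab0 Lp Lq Lx).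
  by right.
by left.
Qed.

End Complete.

Theorem theorem5p6 (R : realType) :
  exists f g : R -> R,
    [/\ bijective f, bijective g, Hamel_function f, Hamel_function g
      & Mazurkiewicz (graph f `|` graph g)].
Proof.
have [H Hadm Hdone] := exists_complete_config R.
have [f [bf fH]] := complete_function Hadm Hdone true.
have [g [bg gH]] := complete_function Hadm Hdone false.
exists f, g; rewrite /Hamel_function fH gH; split => //.
- exact: complete_Hamel.
- exact: complete_Hamel.
- exact: complete_Mazurkiewicz.
Qed.
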